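(* Let $G$ have $n$ vertices and let $Z_0=\operatorname{diag}(z_v)_{v\in V}$, where the $z_v$ are indeterminates. Then $$\det(L_c+Z_0)=m\bigl(\widehat S_{c,z}(G),n\bigr)+\sum_{C\in\mathcal C(G)}(-2)^{p(C)}\,c(C)\,m\bigl(\widehat S_{c,z}(G)-S(C),\,n-|C|\bigr).$$
   Context: $G=(V,E)$ is a finite connected simple undirected graph; each edge $e$ has a conductance $c_e\in\mathbb R_{>0}$. The weighted Laplacian $L_c$ is the $V\times V$ matrix with $(L_c)_{uu}=\sum_{e\ni u}c_e$, $(L_c)_{uv}=-c_{uv}$ if $uv\in E$, and $0$ otherwise. The weighted subdivision graph $S_c(G)$ has vertex set $V\sqcup\{e^*:e\in E\}$ and, for each $e\in E$ and each endpoint $v$ of $e$, an edge $ve^*$ of weight $c_e$. The root-augmented graph $\widehat S_{c,z}(G)$ is obtained from $S_c(G)$ by attaching to every original vertex $v\in V$ a private leaf $\rho_v$ through an edge $v\rho_v$ of weight $z_v$. For a subgraph $C$ of $G$, $S(C)$ is its subdivision, with vertices $V(C)\cup\{e^*:e\in E(C)\}$; subtracting $S(C)$ means deleting all its vertices together with all incident edges. For an edge-weighted graph $H$, $m(H,j)$ is the total weight of its $j$-edge matchings, where the weight of a matching is the product of its edge weights (so $m(H,0)=1$). $\mathcal C(G)$ is the set of nonempty vertex-disjoint unions of cycles of $G$; for $C\in\mathcal C(G)$, $p(C)$ is its number of cycle components, $c(C)=\prod_{e\in E(C)}c_e$, and $|C|$ is its number of vertices (equal to its number of edges). *)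

(* Defs.v *)
From HB Require Import structures.
From mathcomp Require Import all_boot all_order all_algebra.
From mathcomp Require Import mpoly.
Set Implicit Arguments.
Unset Strict Implicit.
Unset Printing Implicit Defensive.
Import Order.TTheory GRing.Theory Num.Theory.
Local Open Scope ring_scope.

(* A finite edge-weighted graph with vertices in W and edges named by elements
   of I: the edge named i joins the elements of [ends i] and has weight [wt i].
   Only the names in [eset] are edges, and only the points in [vset] are
   vertices, so that deleting vertices does not change the types W and I. *)
Record wgraph (W I : finType) (A : Type) := WGraph {
  vset : {set W};
  eset : {set I};
  ends : I -> {set W};
  wt : I -> A }.

Definition delete_vertices (W I : finType) (A : Type)
    (H : wgraph W I A) (X : {set W}) : wgraph W I A :=
  WGraph (vset H :\: X) [set i in eset H | [disjoint ends H i & X]]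
         (ends H) (wt H).

Definition is_matching (W I : finType) (A : Type)
    (H : wgraph W I A) (M : {set I}) : bool :=
  (M \subset eset H) &&
  [forall i in M, forall j in M,
     (i != j) ==> [disjoint ends H i & ends H j]].

Definition matching_weight (W I : finType) (A : comNzRingType)
    (H : wgraph W I A) (j : nat) : A :=
  \sum_(M : {set I} | is_matching H M && (#|M| == j)) \prod_(i in M) wt H i.

Section Graph.

(* A simple graph on V is given by its edge set E, a set of 2-element sets. *)
Variables (V : finType) (E : {set {set V}}).

Definition adj : rel V := fun u v => [set u; v] \in E.

Definition simple_graph : Prop := forall e : {set V}, e \in E -> #|e| = 2%N.

Definition connected_graph : Prop := forall u v : V, connect adj u v.

(* Row and column i correspond to the vertex [enum_val i]. *)
Definition laplacian (A : comNzRingType) (c : {set V} -> A) : 'M[A]_#|V| :=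
  \matrix_(i, j)
    let u := enum_val i in let v := enum_val j in
    if u == v then \sum_(e in E | u \in e) c e
    else if adj u v then - c [set u; v]
    else 0.

Definition diag_vertices (A : comNzRingType) (z : V -> A) : 'M[A]_#|V| :=
  diag_mx (\row_i z (enum_val i)).

Definition aug_vertex : finType := (V + {set V} + V)%type.
Definition orig_vertex (v : V) : aug_vertex := inl (inl v).
Definition mid_vertex (e : {set V}) : aug_vertex := inl (inr e).
Definition leaf_vertex (v : V) : aug_vertex := inr v.

(* [inl (v, e)] names the half-edge from v to the midpoint of e, and [inr v]
   names the edge from v to its private leaf. *)
Definition aug_edge : finType := (V * {set V} + V)%type.

Definition aug_ends (i : aug_edge) : {set aug_vertex} :=
  match i with
  | inl (v, e) => [set orig_vertex v; mid_vertex e]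
  | inr v => [set orig_vertex v; leaf_vertex v]
  end.

Definition aug_wt (A : Type) (c : {set V} -> A) (z : V -> A)
    (i : aug_edge) : A :=
  match i with
  | inl (_, e) => c e
  | inr v => z v
  end.

Definition aug_subdivision (A : Type) (c : {set V} -> A) (z : V -> A) :
    wgraph aug_vertex aug_edge A :=
  WGraph ([set orig_vertex v | v in V] :|: [set mid_vertex e | e in E]
            :|: [set leaf_vertex v | v in V])
         [set i : aug_edge | match i with
                             | inl (v, e) => (e \in E) && (v \in e)
                             | inr _ => true
                             end]
         aug_ends (aug_wt c z).

(* A cycle subgraph, identified with its edge set F: the edges joining
   cyclically consecutive entries of a duplicate-free list of at least three
   vertices. *)
Definition is_cycle (F : {set {set V}}) : bool :=
  [exists k : 'I_#|V|.+1, exists t : k.-tuple V,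
     [&& (2 < k)%N, ucycleb adj t & F == [set [set x; next t x] | x in t]]].

(* A nonempty vertex-disjoint union of cycles, represented by the set of its
   cycle components; [cover] is injective on these families, see
   [cover_cycle_unions_inj]. *)
Definition cycle_unions : {set {set {set {set V}}}} :=
  [set C : {set {set {set V}}} |
     [&& C != set0,
         [forall F in C, is_cycle F] &
         [forall F1 in C, forall F2 in C,
            (F1 != F2) ==> [disjoint cover F1 & cover F2]]]].

Lemma cycle_sub_component (F : {set {set V}}) (C : {set {set {set V}}}) :
  is_cycle F -> C \in cycle_unions -> F \subset cover C ->
  exists2 F', F' \in C & F \subset F'.
Proof.
case/existsP=> k /existsP[t /and3P[kgt2 /andP[_ Ut] /eqP defF]].
rewrite inE => /and3P[_ _ /forall_inP disC] sFC.
have next_in x : x \in t -> next t x \in t by rewrite mem_next.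
have Fe x : x \in t -> [set x; next t x] \in F.
  by move=> xt; rewrite defF; apply/imsetP; exists x.
have /hasP[x0 x0t _] : has predT t.
  by rewrite has_predT size_tuple (leq_trans _ kgt2).
have [F' F'C x0F'] : exists2 F', F' \in C & [set x0; next t x0] \in F'.
  by have /bigcupP[F' ? ?] := subsetP sFC _ (Fe _ x0t); exists F'.
exists F' => //.
have step x y z : [set x; y] \in F' -> [set y; z] \in cover C ->
    [set y; z] \in F'.
  move=> xyF' /bigcupP[F2 F2C yF2].
  have yc' : y \in cover F' by apply/bigcupP; exists [set x; y] => //; exact: set22.
  have yc2 : y \in cover F2 by apply/bigcupP; exists [set y; z] => //; exact: set21.
  have [->//|neqF] := eqVneq F' F2.
  have := forall_inP (disC _ F'C) _ F2C; rewrite neqF /= => dis.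
  by have := disjointFr dis yc'; rewrite yc2.
have it m : (iter m (next t) x0 \in t) /\
    ([set iter m (next t) x0; next t (iter m (next t) x0)] \in F').
  elim: m => [|m [IHt IHF]]; first by split.
  rewrite iterS; split; first exact: next_in.
  by apply: step IHF _; apply: (subsetP sFC); apply/Fe/next_in.
apply/subsetP=> e; rewrite defF => /imsetP[x xt ->].
have fc := cycle_next Ut.
have /iter_findex <- : fconnect (next t) x0 x by rewrite (fconnect_cycle fc x0t).
by case: (it (findex (next t) x0 x)).
Qed.

Lemma cover_cycle_neq0 (F : {set {set V}}) : is_cycle F -> cover F != set0.
Proof.
case/existsP=> k /existsP[t /and3P[kgt2 _ /eqP ->]].
have /hasP[x0 x0t _] : has predT t.
  by rewrite has_predT size_tuple (leq_trans _ kgt2).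
apply/set0Pn; exists x0; apply/bigcupP.
exists [set x0; next t x0]; last exact: set21.
by apply/imsetP; exists x0.
Qed.

Lemma cover_cycle_unions_inj :
  {in cycle_unions &, injective (fun C => cover C)}.
Proof.
suff sub C1 C2 : C1 \in cycle_unions -> C2 \in cycle_unions ->
    cover C1 = cover C2 -> C1 \subset C2.
  by move=> C1 C2 h1 h2 eqC; apply/eqP; rewrite eqEsubset !sub.
move=> C1u C2u eqC; apply/subsetP=> F FC1.
have /and3P[_ /forall_inP cyc1 /forall_inP dis1] :
    [&& C1 != set0, [forall F in C1, is_cycle F] &
        [forall F1 in C1, forall F2 in C1,
           (F1 != F2) ==> [disjoint cover F1 & cover F2]]].
  by move: C1u; rewrite inE.
have cyc2 F2 : F2 \in C2 -> is_cycle F2.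
  by move: C2u; rewrite inE => /and3P[_ /forall_inP + _]; apply.
have [F2 F2C2 sF2] : exists2 F', F' \in C2 & F \subset F'.
  by apply: cycle_sub_component; rewrite ?cyc1 // -eqC (bigcup_sup F).
have [F3 F3C1 sF3] : exists2 F', F' \in C1 & F2 \subset F'.
  by apply: cycle_sub_component; rewrite ?cyc2 // eqC (bigcup_sup F2).
have eqF : F = F3.
  apply/eqP; apply: contraT => neqF.
  have := forall_inP (dis1 _ FC1) _ F3C1; rewrite neqF /= => dF.
  have /set0Pn[x xF] := cover_cycle_neq0 (cyc1 _ FC1).
  have /pred0P/(_ x) := dF; rewrite /= xF /=.
  case/bigcupP: xF => e eF xe; move/negP; case.
  by apply/bigcupP; exists e; rewrite // (subsetP sF3) // (subsetP sF2).
suff <- : F2 = F by [].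
by apply/eqP; rewrite eqEsubset sF2 andbT eqF.
Qed.

Definition union_edges (C : {set {set {set V}}}) : {set {set V}} := cover C.
Definition union_vertices (C : {set {set {set V}}}) : {set V} :=
  cover (union_edges C).
Definition n_cycles (C : {set {set {set V}}}) : nat := #|C|.

Definition subdivision_vertices (C : {set {set {set V}}}) : {set aug_vertex} :=
  [set orig_vertex v | v in union_vertices C]
    :|: [set mid_vertex e | e in union_edges C].

End Graph.

(* Main.v *)
Require Import Defs.
From HB Require Import structures.
From mathcomp Require Import all_boot all_order all_algebra.
From mathcomp Require Import fingroup perm.
From mathcomp Require Import mpoly.
Set Implicit Arguments.
Unset Strict Implicit.
Unset Printing Implicit Defensive.
Import Order.TTheory GRing.Theory Num.Theory.
Local Open Scope ring_scope.

(* Row v of L_c + Z_0 is a sum over the half-edges at v (including the leaf edge)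
   of weight times e_v - e_w, or e_v for the leaf, so by multilinearity the
   determinant is a sum over choices f of one half-edge per vertex.  If f uses an
   edge twice, two rows are opposite and the term vanishes.  Otherwise the
   permutation expansion leaves the permutations s such that f moves along
   {v, s v} at every non-fixed v, each with sign (-1)^(number of nontrivial
   cycles); no such s has a 2-cycle.  Summing over f first, for fixed s, gives the
   weight of the cycles of s times the weight of the matchings of size n - |s| in
   the graph without the subdivided cycles.  Finally a union C of p(C) cycles comes
   from the 2^p(C) permutations given by its orientations. *)

(** * Determinants with rows and columns indexed by a finite type *)

Section DetFintype.
Variables (V : finType) (A : comNzRingType).

Lemma enum_perm_inj (s : 'S_#|V|) :
  injective (fun v : V => enum_val (s (enum_rank v))).
Proof. by move=> u v /enum_val_inj/perm_inj/enum_rank_inj. Qed.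

Definition enum_perm (s : 'S_#|V|) : {perm V} := perm (@enum_perm_inj s).

(** Conjugation by the enumeration is a morphism that sends transpositions to transpositions, so a
    factorisation into transpositions is transported factor by factor. *)
Lemma odd_enum_perm (s : 'S_#|V|) : odd_perm (enum_perm s) = odd_perm s.
Proof.
have enum1 : enum_perm 1 = 1%g.
  by apply/permP=> v; rewrite permE perm1 enum_rankK perm1.
have enumM (p q : 'S_#|V|) : enum_perm (p * q)%g = (enum_perm p * enum_perm q)%g.
  by apply/permP=> v; rewrite !permE /= !permE enum_valK.
have [ts -> dts] := prod_tpermP s.
elim: ts dts => [|[i j] ts IHts] /=; first by rewrite big_nil enum1 !odd_perm1.
case/andP=> neq_ij {}/IHts IH; rewrite big_cons enumM !odd_permM IH.
congr (_ (+) _).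
have -> : enum_perm (tperm i j) = tperm (enum_val i) (enum_val j).
  apply/permP=> v; rewrite permE -[v in RHS]enum_rankK.
  by rewrite inj_tperm; last exact: enum_val_inj.
by rewrite !odd_tperm (inj_eq enum_val_inj).
Qed.

Lemma det_enum_val (M : V -> V -> A) :
  \det (\matrix_(i < #|V|, j < #|V|) M (enum_val i) (enum_val j)) =
    \sum_(s : {perm V}) (-1) ^+ s * \prod_v M v (s v).
Proof.
have enum_inj : injective enum_perm.
  move=> p q /permP eqpq; apply/permP=> i; apply: enum_val_inj.
  by have := eqpq (enum_val i); rewrite !permE enum_valK.
have enum_bij : bijective enum_perm.
  have cardS (T : finType) : #|{perm T}| = #|T|`!.
    rewrite -[#|T|]cardsT -card_perm; apply: eq_card => p.
    by rewrite inE; apply/esym/subsetP=> x; rewrite inE.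
  by apply: inj_card_bij => //; rewrite !cardS card_ord.
rewrite (reindex enum_perm) /=; last exact: onW_bij.
apply: eq_bigr => s _; rewrite odd_enum_perm; congr (_ * _).
rewrite [RHS](reindex (@enum_val V predT)) /=; last exact/onW_bij/enum_val_bij.
by apply: eq_bigr => i _; rewrite mxE permE enum_valK.
Qed.

(** By linearity in row [u], the determinant is -1 times one with two equal rows; this works in
    every characteristic. *)
Lemma sum_perm_opp_rows (M : V -> V -> A) (u v : V) :
  u != v -> M u =1 (fun w => - M v w) ->
  \sum_(s : {perm V}) (-1) ^+ s * \prod_w M w (s w) = 0.
Proof.
move=> neq_uv Muv; rewrite -det_enum_val.
set X := \matrix_(_, _) _.
pose i := enum_rank u; pose j := enum_rank v.
have neq_ij : i != j by rewrite (inj_eq enum_rank_inj).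
pose Y := \matrix_(k < #|V|, l < #|V|) if k == i then X j l else X k l.
have Y0 : \det Y = 0.
  apply: (determinant_alternate neq_ij) => l.
  by rewrite !mxE eqxx eq_sym (negPf neq_ij).
rewrite (@determinant_multilinear _ _ X Y Y i (-1) 0) ?Y0 ?mulr0 ?addr0 //.
- apply/rowP=> l; rewrite !mxE eqxx mul0r addr0 mulN1r.
  by rewrite !enum_rankK Muv.
- by apply/matrixP=> k l; rewrite !mxE eq_sym (negPf (neq_lift _ _)).
- by apply/matrixP=> k l; rewrite !mxE eq_sym (negPf (neq_lift _ _)).
Qed.
End DetFintype.

(** * Expansion of the Laplacian rows over half-edge choices *)

Lemma edge_set2 (V : finType) (E : {set {set V}}) (e : {set V}) (v w : V) :
  simple_graph E -> e \in E -> v \in e -> w \in e -> w != v -> e = [set v; w].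
Proof.
move=> simpE eE ve we neq_wv; apply/esym/eqP.
by rewrite eqEcard subUset !sub1set ve we cards2 eq_sym neq_wv simpE.
Qed.

Section HalfEdgeChoices.
Variables (V : finType) (E : {set {set V}}) (A : comNzRingType).
Variables (c : {set V} -> A) (z : V -> A).
Implicit Types (f : {ffun V -> option {set V}}) (s : {perm V}).

(* [None] stands for the private leaf. *)
Definition half_edge (v : V) (o : option {set V}) : aug_edge V :=
  if o is Some e then inl (v, e) else inr v.

Definition incident (v : V) (o : option {set V}) : bool :=
  if o is Some e then (e \in E) && (v \in e) else true.

Definition half_wt (v : V) (o : option {set V}) : A :=
  aug_wt c z (half_edge v o).

(** Leaves are private, so [None] may be chosen at any number of vertices; only a shared edge is a
    conflict. *)
Definition separated f : bool :=
  [forall u, forall v, (u != v) && (f u == f v) ==> (f u == None)].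

Definition perm_support s : {set V} := [set v | s v != v].

Definition follows s f : bool :=
  [forall v in perm_support s, f v == Some [set v; s v]].

(** For an edge [e] at [v] with other endpoint x, this is the coordinate at [w] of e_v - e_x,
    written so that x need not be named. *)
Definition row_summand (v : V) (o : option {set V}) (w : V) : A :=
  if o is Some e then (w == v)%:R - ((w != v) && (w \in e))%:R
  else (w == v)%:R.

Definition laplacian_entry (u v : V) : A :=
  (if u == v then \sum_(e in E | u \in e) c e
   else if adj E u v then - c [set u; v] else 0) + z u *+ (u == v).

Hypothesis simpE : simple_graph E.

Lemma laplacian_entryE (u v : V) :
  laplacian_entry u v = \sum_(o | incident u o) half_wt u o * row_summand u o v.
Proof.
rewrite (bigD1 None) //= addrC {1}/half_wt /= [v == u]eq_sym mulr_natr.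
congr (_ + _).
rewrite (reindex_omap Some id) /=; last by case.
under [RHS]eq_bigl do rewrite eqxx !andbT.
case: eqVneq => [<-|neq_uv].
  by apply: eq_bigr => e _; rewrite subr0 mulr1.
have neq_vu : v != u by rewrite eq_sym.
case: ifP => adj_uv.
  rewrite (bigD1 [set u; v]) /=; last by rewrite set21 andbT.
  rewrite set22 sub0r mulrN1 big1 ?addr0 // => e.
  case/andP=> /andP[eE ue] neq_e.
  case: (boolP (v \in e)) => ve; last by rewrite subr0 mulr0.
  by rewrite (edge_set2 simpE eE ue ve neq_vu) eqxx in neq_e.
rewrite big1 // => e /andP[eE ue] /=.
case: (boolP (v \in e)) => ve; last by rewrite subr0 mulr0.
by rewrite /adj -(edge_set2 simpE eE ue ve neq_vu) eE in adj_uv.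
Qed.

(** A fixed point contributes 1. At a moved [v] the factor is -1 if [s v] is the other endpoint of
    the chosen edge; otherwise it is 0 and kills the product. *)
Lemma prod_row_summand f s : f \in family incident ->
  \prod_v row_summand v (f v) (s v) =
    if follows s f then (-1) ^+ #|perm_support s| else 0.
Proof.
move/familyP=> incf; case: ifPn => [/forall_inP fol|].
  rewrite -prodr_const [RHS]big_mkcond /=; apply: eq_bigr => v _.
  case: ifP => [vs | /negbT]; last first.
    rewrite inE negbK => /eqP ->; rewrite /row_summand.
    by case: (f v) => [e|]; rewrite ?eqxx ?subr0.
  rewrite (eqP (fol v vs)) /row_summand set22; move: vs; rewrite inE => svv.
  by rewrite (negPf svv) sub0r.
rewrite negb_forall => /existsP[v].
rewrite negb_imply inE => /andP[svv fv].
rewrite (bigD1 v) //= /row_summand.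
have := incf v; rewrite unfold_in; case: (f v) fv => [e|] /= neq_e.
  case/andP=> eE ve; case: (boolP (s v \in e)) => sve; last first.
    by rewrite (negPf svv) subr0 mul0r.
  by rewrite (edge_set2 simpE eE ve sve svv) eqxx in neq_e.
by rewrite (negPf svv) mul0r.
Qed.

(** If [u] and [v] choose the same edge, it joins them, and their rows are e_u - e_v and e_v -
    e_u. *)
Lemma sum_perm_rows_not_separated f :
  f \in family incident -> ~~ separated f ->
  \sum_(s : {perm V}) (-1) ^+ s * \prod_v row_summand v (f v) (s v) = 0.
Proof.
move/familyP=> incf; rewrite negb_forall => /existsP[u].
rewrite negb_forall => /existsP[v].
rewrite negb_imply => /andP[/andP[neq_uv /eqP eq_f] fu].
apply: (@sum_perm_opp_rows _ _ (fun x => row_summand x (f x)) u v neq_uv) => w.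
have := incf u; have := incf v; rewrite -eq_f !unfold_in.
case: (f u) fu => // e _ /= /andP[eE ve] /andP[_ ue].
have neq_vu : v != u by rewrite eq_sym.
rewrite (edge_set2 simpE eE ue ve neq_vu) !inE opprB.
have [->|] := eqVneq w u; first by rewrite (negPf neq_uv) /= !subr0.
by have [->|] := eqVneq w v; rewrite ?subrr.
Qed.

(** Exchanging sums makes the inner sum over [s] a determinant for each fixed [f], which discards
    the non-separated choices; exchanging back leaves a sum over [f] for each [s]. *)
Lemma sum_perm_laplacian_entry :
  \sum_(s : {perm V}) (-1) ^+ s * \prod_v laplacian_entry v (s v) =
  \sum_(s : {perm V}) (-1) ^+ (s + #|perm_support s|)%N *
    \sum_(f in family incident | separated f && follows s f)
      \prod_v half_wt v (f v).
Proof.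
under eq_bigr => s _.
  under eq_bigr do rewrite laplacian_entryE.
  rewrite bigA_distr_big_dep big_distrr /=.
  under eq_bigr do rewrite big_split /= mulrCA.
  over.
rewrite exchange_big /= (bigID separated) /= addrC big1 ?add0r; last first.
  move=> f /andP[incf nsep].
  by rewrite -big_distrr /= sum_perm_rows_not_separated ?mulr0.
under [LHS]eq_bigr => f /andP[incf _].
  under eq_bigr do rewrite prod_row_summand //.
  over.
rewrite exchange_big; apply: eq_bigr => s _ /=.
rewrite big_distrr [RHS]big_mkcond [LHS]big_mkcond /=.
apply: eq_bigr => f _; rewrite andbA; case: (_ && _) => //=.
by case: ifP => _; rewrite ?mulr0 // mulrC exprD.
Qed.

End HalfEdgeChoices.

(** * Permutations without 2-cycles and their edges *)

Lemma disjoint_set2 (T : finType) (a b : T) (D : {set T}) :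
  [disjoint [set a; b] & D] = (a \notin D) && (b \notin D).
Proof. by rewrite disjoints_subset subUset !sub1set !inE. Qed.

Lemma mem_perm_support (V : finType) (s : {perm V}) (v : V) :
  (s v \in perm_support s) = (v \in perm_support s).
Proof. by rewrite !inE (inj_eq perm_inj). Qed.

Section CyclePermutations.
Variables (V : finType) (E : {set {set V}}).
Implicit Types (s : {perm V}).

Definition perm_edges s : {set {set V}} :=
  [set [set v; s v] | v in perm_support s].

(** Excluding 2-cycles forces every nontrivial orbit to have at least three points, so that it
    traces a genuine cycle of the graph. *)
Definition cycle_perm s : bool :=
  [forall v in perm_support s, ([set v; s v] \in E) && (s (s v) != v)].

Lemma perm_edges_sub_support s (e : {set V}) :
  e \in perm_edges s -> e \subset perm_support s.
Proof.
by case/imsetP=> v vs ->; rewrite subUset !sub1set mem_perm_support vs.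
Qed.

Lemma cover_perm_edges s : cover (perm_edges s) = perm_support s.
Proof.
apply/eqP; rewrite eqEsubset; apply/andP; split.
  by apply/bigcupsP=> e; apply: perm_edges_sub_support.
apply/subsetP=> v vs; apply/bigcupP; exists [set v; s v]; last exact: set21.
exact: imset_f.
Qed.

(** Two distinct points with the same edge would be swapped by [s], a 2-cycle. *)
Lemma perm_edge_inj s : cycle_perm s ->
  {in perm_support s &, injective (fun v => [set v; s v])}.
Proof.
move/forall_inP=> cyc u v us vs /setP eq_uv.
have /andP[_ ssv] := cyc v vs.
have := eq_uv u; rewrite set21 => /esym/set2P[//|eq_u].
have := eq_uv v; rewrite set21 => /set2P[//|eq_v].
by rewrite -eq_u -eq_v eqxx in ssv.
Qed.

End CyclePermutations.

(** * Choices following a permutation, and matchings off its cycles *)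

Section Matchings.
Variables (V : finType) (E : {set {set V}}) (A : comNzRingType).
Variables (c : {set V} -> A) (z : V -> A).
Implicit Types (f : {ffun V -> option {set V}}) (s : {perm V}).

Definition half_base (i : aug_edge V) : V :=
  match i with inl (v, _) => v | inr v => v end.

Definition far_end (v : V) (o : option {set V}) : aug_vertex V :=
  if o is Some e then mid_vertex e else leaf_vertex v.

Lemma half_edge_inj (v : V) : injective (half_edge v).
Proof. by move=> [e|] [e'|] // [->]. Qed.

Lemma half_base_edge (v : V) o : half_base (half_edge v o) = v.
Proof. by case: o. Qed.

Lemma half_edge_base i : exists o, i = half_edge (half_base i) o.
Proof. by case: i => [[v e]|v]; [exists (Some e) | exists None]. Qed.

Lemma aug_ends_half_edge (v : V) o :
  aug_ends (half_edge v o) = [set orig_vertex v; far_end v o].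
Proof. by case: o. Qed.

Lemma separatedP f :
  reflect (forall u v, u != v -> f u = f v -> f u = None) (separated f).
Proof.
apply: (iffP forallP) => [sep u v neq_uv eq_f | sep u].
  by apply/eqP; have /forallP/(_ v) := sep u; rewrite neq_uv eq_f eqxx.
apply/forallP=> v; apply/implyP=> /andP[neq_uv /eqP eq_f].
exact/eqP/(sep u v).
Qed.

Definition support_subdivision s : {set aug_vertex V} :=
  [set orig_vertex v | v in perm_support s]
    :|: [set mid_vertex e | e in perm_edges s].

Lemma orig_in_subdivision s v :
  (orig_vertex v \in support_subdivision s) = (v \in perm_support s).
Proof.
rewrite inE mem_imset; last by move=> ? ? [].
by rewrite orbC; case: imsetP => // [[]].
Qed.

Lemma mid_in_subdivision s e :
  (mid_vertex e \in support_subdivision s) = (e \in perm_edges s).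
Proof.
rewrite inE [X in _ || X]mem_imset; last by move=> ? ? [].
by case: imsetP => // [[]].
Qed.

Lemma leaf_in_subdivision s v : (leaf_vertex v \in support_subdivision s) = false.
Proof. by rewrite inE; case: imsetP => [[]|_] //; case: imsetP => [[]|_]. Qed.

Section Fixed_perm.
Variable s : {perm V}.
Hypothesis cyc : cycle_perm E s.
Notation X := (perm_support s).
Notation H := (delete_vertices (aug_subdivision E c z) (support_subdivision s)).

Definition choice_matching f : {set aug_edge V} :=
  [set half_edge v (f v) | v in ~: X].

(** On the support the value is forced by [s]. Elsewhere the default [None] is harmless:
    [choice_matching f] and the matchings of the required size contain a half-edge at every vertex
    off the support. *)
Definition matching_choice (M : {set aug_edge V}) :
    {ffun V -> option {set V}} :=
  [ffun v => if v \in X then Some [set v; s v]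
             else odflt None [pick o | half_edge v o \in M]].

(** Deleting midpoints costs nothing at a surviving vertex: the edges of [s] lie inside the support,
    so none of them is incident to it. *)
Lemma half_edge_in_deleted v o :
  (half_edge v o \in eset H) = (v \notin X) && incident E v o.
Proof.
rewrite inE /= aug_ends_half_edge disjoint_set2 orig_in_subdivision.
have -> : (half_edge v o \in eset (aug_subdivision E c z)) = incident E v o.
  by rewrite inE; case: o.
case: (boolP (v \in X)) => vX /=; rewrite ?andbF // andbC.
case: o => [e|] /=; last by rewrite leaf_in_subdivision.
rewrite mid_in_subdivision; case: (boolP (e \in perm_edges s)) => //= eY.
apply/esym/negbTE/negP=> /andP[_ ve].
by rewrite (subsetP (perm_edges_sub_support eY)) in vX.
Qed.

Lemma choice_matchingK f : matching_choice (choice_matching f) = f ->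
  follows s f.
Proof.
move/ffunP=> eq_f; apply/forall_inP=> v vX.
by rewrite -eq_f ffunE vX.
Qed.

Lemma mem_choice_matching f v o :
  (half_edge v o \in choice_matching f) = (v \notin X) && (o == f v).
Proof.
apply/imsetP/andP=> [[u]|[vX /eqP ->]]; last by exists v; rewrite ?in_setC.
rewrite in_setC => uX eq_vu.
have eq_v : v = u by rewrite -(half_base_edge v o) eq_vu half_base_edge.
by subst u; rewrite (half_edge_inj eq_vu).
Qed.

Lemma choice_matching_follows f : follows s f ->
  matching_choice (choice_matching f) = f.
Proof.
move/forall_inP=> fol; apply/ffunP=> v; rewrite ffunE.
case: ifPn => [/fol/eqP->// | vX].
case: pickP => [o | /(_ (f v))]; rewrite mem_choice_matching vX /=.
  by move/eqP.
by rewrite eqxx.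
Qed.

Lemma card_choice_matching f : #|choice_matching f| = (#|V| - #|X|)%N.
Proof.
rewrite card_in_imset; first by rewrite cardsCs setCK.
move=> u v _ _ eq_uv.
by rewrite -(half_base_edge u (f u)) eq_uv half_base_edge.
Qed.

(** Half-edges based at distinct vertices can meet only in a midpoint, so the matching condition is
    separation off the support. A choice off the support cannot clash with one on it, whose edge has
    both ends in the support; on the support, separation follows from the absence of 2-cycles. *)
Lemma is_matching_choice f : follows s f ->
  is_matching H (choice_matching f) = (f \in family (incident E)) && separated f.
Proof.
move/forall_inP=> fol; have /forall_inP cyc' := cyc.
have sub_inc : (choice_matching f \subset eset H) = (f \in family (incident E)).
  apply/subsetP/familyP=> [sub v|inc i /imsetP[v]].
    rewrite unfold_in; case: (boolP (v \in X)) => [vX|vX].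
      rewrite (eqP (fol v vX)) /= set21 andbT.
      by have /andP[] := cyc' v vX.
    have := sub (half_edge v (f v)).
    by rewrite mem_choice_matching vX eqxx half_edge_in_deleted vX; apply.
  by rewrite in_setC => vX ->; rewrite half_edge_in_deleted vX; exact: inc.
rewrite /is_matching sub_inc; case: (boolP (f \in _)) => //= /familyP inc.
have in_X v u : v \in X -> f v = f u -> u \in X.
  move=> vX eq_f; have := inc u; rewrite unfold_in -eq_f (eqP (fol v vX)).
  by case/andP=> _ /set2P[] ->; rewrite ?mem_perm_support.
apply/forall_inP/separatedP=> [dis u v neq_uv eq_f | sep i].
  case: (boolP (u \in X)) => uX.
    have vX := in_X _ _ uX eq_f.
    move: eq_f; rewrite (eqP (fol u uX)) (eqP (fol v vX)) => -[eq_uv].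
    by rewrite (perm_edge_inj cyc uX vX eq_uv) eqxx in neq_uv.
  have vX : v \notin X by apply: contra uX => vX; exact: in_X (esym eq_f).
  have := dis (half_edge u (f u)); rewrite mem_choice_matching uX eqxx.
  move=> /(_ isT)/forall_inP/(_ (half_edge v (f v))).
  rewrite mem_choice_matching vX eqxx => /(_ isT)/implyP.
  case: eqP => [eq_uv _|_ /(_ isT)].
    by rewrite -(half_base_edge u (f u)) eq_uv half_base_edge eqxx in neq_uv.
  rewrite /= !aug_ends_half_edge -eq_f; case: (f u) => // e.
  by rewrite disjoint_set2 set22 andbF.
case/imsetP=> u; rewrite in_setC => uX ->; apply/forall_inP=> j /imsetP[v].
rewrite in_setC => vX ->; apply/implyP=> neq_uv.
have {}neq_uv : u != v by apply: contra neq_uv => /eqP ->.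
have orig_far x y o : orig_vertex x <> far_end y o by case: o.
have sep_uv := sep _ _ neq_uv.
rewrite /= !aug_ends_half_edge disjoint_set2 !inE.
apply/andP; split; apply/negP=> /orP[]/eqP.
- by case=> eq_uv; rewrite eq_uv eqxx in neq_uv.
- exact: orig_far.
- by move/esym; apply: orig_far.
case fu: (f u) sep_uv => [e|]; case fv: (f v) => [e'|] //=.
  by move=> sep_uv [eq_e]; rewrite eq_e in sep_uv; have := sep_uv erefl.
by move=> _ [eq_uv]; rewrite eq_uv eqxx in neq_uv.
Qed.

(** Every remaining edge is based at one original vertex off the support, and disjoint edges have
    distinct bases. A matching with as many edges as there are such vertices therefore has exactly
    one edge at each. *)
Lemma matching_choiceK (M : {set aug_edge V}) :
  is_matching H M -> #|M| = (#|V| - #|X|)%N ->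
  choice_matching (matching_choice M) = M.
Proof.
case/andP=> /subsetP subM /forall_inP disM cardM.
have injM : {in M &, injective half_base}.
  move=> i j iM jM eq_ij; apply/eqP/negP=> /negP neq_ij.
  have := forall_inP (disM i iM) j jM; rewrite neq_ij /=.
  have [o ->] := half_edge_base i; have [o' ->] := half_edge_base j.
  by rewrite !aug_ends_half_edge eq_ij disjoint_set2 set21.
have baseX i : i \in M -> half_base i \notin X.
  move=> /subM; have [o {1}->] := half_edge_base i.
  by rewrite half_edge_in_deleted => /andP[].
have imM : half_base @: M = ~: X.
  apply/eqP; rewrite eqEcard [#|half_base @: M|]card_in_imset //.
  rewrite [#|~: X|]cardsCs setCK cardM leqnn andbT.
  by apply/subsetP=> _ /imsetP[i iM ->]; rewrite in_setC baseX.
have mem_sel v : v \notin X -> half_edge v (matching_choice M v) \in M.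
  move=> vX; rewrite ffunE (negPf vX).
  have /imsetP[i iM ->] : v \in half_base @: M by rewrite imM in_setC.
  have [o eq_i] := half_edge_base i.
  by case: pickP => [//|/(_ o)]; rewrite -eq_i iM.
apply/setP=> i; apply/imsetP/idP=> [[v]|iM].
  by rewrite in_setC => vX ->; exact: mem_sel.
have iX := baseX i iM; exists (half_base i); first by rewrite in_setC.
by apply: injM; rewrite ?mem_sel ?half_base_edge.
Qed.

(** Vertices of the support contribute the weights of the edges of [s]; the other vertices
    contribute the weight of the matching. *)
Lemma sum_choices_matching :
  \sum_(f in family (incident E) | separated f && follows s f)
     \prod_v half_wt c z v (f v) =
  (\prod_(e in perm_edges s) c e) * matching_weight H (#|V| - #|X|)%N.
Proof.
rewrite /matching_weight big_distrr /=.
rewrite (reindex_onto choice_matching matching_choice); last first.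
  by move=> M /andP[? /eqP]; exact: matching_choiceK.
apply: eq_big => [f | f /andP[_ /andP[_ fol]]].
  rewrite card_choice_matching eqxx andbT; apply/idP/idP.
    case/andP=> inc /andP[sep fol].
    by rewrite choice_matching_follows // is_matching_choice // inc sep eqxx.
  case/andP=> matf /eqP/choice_matchingK fol.
  by rewrite is_matching_choice // in matf; case/andP: matf => -> ->.
rewrite (bigID (mem X)) /= /perm_edges big_imset /=; last first.
  exact: perm_edge_inj cyc.
congr (_ * _).
  apply: eq_bigr => v vX.
  by have /forall_inP/(_ v vX)/eqP -> := fol.
rewrite big_imset /=; last first.
  by move=> u v _ _ eq_uv; rewrite -(half_base_edge u (f u)) eq_uv half_base_edge.
by apply: eq_bigl => v; rewrite in_setC.
Qed.

End Fixed_perm.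
End Matchings.

(** * Correspondence between permutations and unions of cycles *)

Section CycleFamilies.
Variables (V : finType) (E : {set {set V}}).
Implicit Types (s t : {perm V}).

Definition edges_from s (B : {set V}) : {set {set V}} :=
  [set [set y; s y] | y in B].

Definition cycle_family s : {set {set {set V}}} :=
  [set edges_from s (porbit s x) | x in perm_support s].

Lemma perm_in_porbit s x y : (s y \in porbit s x) = (y \in porbit s x).
Proof.
by rewrite porbit_sym [RHS]porbit_sym -(porbit_perm s 1 y) expg1.
Qed.

Lemma porbit_support s x y :
  y \in porbit s x -> (y \in perm_support s) = (x \in perm_support s).
Proof.
case/porbitP=> i ->; elim: i => [|i IHi]; first by rewrite expg0 perm1.
by rewrite expgSr permM mem_perm_support.
Qed.

Lemma cover_edges_from s x : cover (edges_from s (porbit s x)) = porbit s x.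
Proof.
apply/setP=> y; apply/bigcupP/idP=> [[_ /imsetP[w wx ->]]|yx].
  by case/set2P=> ->; rewrite ?perm_in_porbit.
exists [set y; s y]; last exact: set21.
by apply/imsetP; exists y.
Qed.

Lemma cover_cycle_family s : cover (cycle_family s) = perm_edges s.
Proof.
apply/setP=> e; apply/bigcupP/imsetP=> [[_ /imsetP[x xs ->]]|[x xs ->]].
  by case/imsetP=> y yx ->; exists y; rewrite ?(porbit_support yx).
exists (edges_from s (porbit s x)); first exact: imset_f.
by apply/imsetP; exists x; rewrite ?porbit_id.
Qed.

(** An orbit is recovered from its edges as their cover, so distinct orbits have distinct edge
    sets. *)
Lemma card_cycle_family s :
  #|cycle_family s| = #|[set porbit s x | x in perm_support s]|.
Proof.
rewrite /cycle_family [X in #|pred_of_set X|](imset_comp (edges_from s)).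
rewrite [LHS]card_in_imset // => _ _ /imsetP[x _ ->] /imsetP[y _ ->] eq_xy.
by rewrite -[LHS]cover_edges_from eq_xy cover_edges_from.
Qed.

(** The parity of [s] is that of #|V| plus its number of orbits. Each fixed point is one vertex and
    one orbit, so fixed points cancel, leaving the support and the nontrivial orbits. *)
Lemma odd_card_cycle_family s :
  odd (#|cycle_family s|) = odd_perm s (+) odd #|perm_support s|.
Proof.
rewrite card_cycle_family /odd_perm.
have fixed x : x \notin perm_support s -> porbit s x = [set x].
  move=> xs; apply/setP=> y; rewrite inE; apply/porbitP/eqP=> [[i ->]|->].
    elim: i => [|i IHi]; first by rewrite expg0 perm1.
    by rewrite expgSr permM IHi; move: xs; rewrite inE negbK => /eqP.
  by exists 0%N; rewrite expg0 perm1.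
have -> : porbits s = porbit s @: perm_support s :|: porbit s @: ~: perm_support s.
  rewrite -imsetU setUCr; apply/setP=> B.
  by apply/imsetP/imsetP=> -[x _ ->]; exists x; rewrite ?inE.
rewrite cardsU (_ : _ :&: _ = set0) ?cards0 ?subn0; last first.
  apply/setP=> B; rewrite !inE; apply/negP=> /andP[/imsetP[x xs ->]].
  case/imsetP=> y; rewrite in_setC => ys eq_xy.
  have : y \in porbit s x by rewrite eq_xy porbit_id.
  by move/porbit_support; rewrite xs (negPf ys).
rewrite [X in (_ + X)%N]card_in_imset; last first.
  move=> x y; rewrite !in_setC => xs ys; rewrite !fixed // => /setP/(_ x).
  by rewrite !inE eqxx => /esym/eqP.
rewrite oddD -(cardsC (perm_support s)) oddD.
by do 3!case: odd.
Qed.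

(** The sign of [s] and the factors -1 of the moved rows combine into one -1 per nontrivial
    cycle. *)
Lemma sign_cycle_family (A : comNzRingType) s :
  (-1) ^+ (s + #|perm_support s|)%N = (-1) ^+ #|cycle_family s| :> A.
Proof. by rewrite -signr_odd oddD oddb -odd_card_cycle_family signr_odd. Qed.

Lemma porbit_fconnect s x y : (y \in porbit s x) = fconnect s x y.
Proof.
apply/porbitP/idP=> [[i ->]|/iter_findex <-].
  by rewrite permX fconnect_iter.
by exists (findex s x y); rewrite permX.
Qed.

Lemma is_cycle_edges_from s x : cycle_perm E s -> x \in perm_support s ->
  is_cycle E (edges_from s (porbit s x)).
Proof.
move=> /forall_inP cyc xs; pose t := orbit s x.
have mem_t y : (y \in t) = (y \in porbit s x).
  by rewrite -fconnect_orbit porbit_fconnect.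
have fcyc : fcycle s t by apply: cycle_orbit; exact: perm_inj.
have ut : uniq t by exact: orbit_uniq.
have lt_t : (size t < #|V|.+1)%N by rewrite ltnS -(card_uniqP ut) max_card.
apply/existsP; exists (Ordinal lt_t); apply/existsP; exists (in_tuple t).
apply/and3P; split=> /=.
- have /andP[_ ssx] := cyc x xs.
  (* The points [x], [s x] and [s (s x)] are distinct, which gives length at least three. *)
  apply: (@uniq_leq_size _ [:: x; s x; s (s x)]) => /=.
    have sx : s x != x by move: xs; rewrite inE.
    rewrite !inE !negb_or !andbT (inj_eq perm_inj).
    by rewrite ![x == _]eq_sym sx ssx.
  by move=> y; rewrite !inE mem_t => /or3P[]/eqP->; rewrite ?perm_in_porbit porbit_id.
- rewrite /ucycleb ut andbT; apply: (@sub_in_cycle _ (mem t)) fcyc.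
    move=> y w; rewrite /in_mem /= -[mem_seq _ _]/(y \in t) mem_t => yx _ /eqP <-.
    have ys : y \in perm_support s by rewrite (porbit_support yx).
    by have /andP[] := cyc y ys.
  by apply/allP.
apply/eqP/setP=> e; apply/imsetP/imsetP=> -[y yx ->]; exists y.
- by rewrite mem_t.
- by rewrite -(eqP (next_cycle fcyc _)) ?mem_t.
- by rewrite -mem_t.
by rewrite -(eqP (next_cycle fcyc _)).
Qed.

Lemma cycle_family_unions s : cycle_perm E s -> s != 1%g ->
  cycle_family s \in cycle_unions E.
Proof.
move=> cyc s1; rewrite inE; apply/and3P; split.
- apply: contra s1 => /eqP cf0; apply/eqP/permP=> x; rewrite perm1.
  apply/eqP; have := in_set0 (edges_from s (porbit s x)).
  by apply: contraFT => xs; rewrite -cf0; apply: imset_f; rewrite inE.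
- by apply/forall_inP=> _ /imsetP[x xs ->]; exact: is_cycle_edges_from.
apply/forall_inP=> _ /imsetP[x xs ->]; apply/forall_inP=> _ /imsetP[y ys ->].
apply/implyP; apply: contraR => /pred0Pn[w]; rewrite /= !cover_edges_from.
by case/andP; rewrite -!eq_porbit_mem => /eqP -> /eqP ->.
Qed.

(** Rotate the list so that it starts with [v], [a], [b]: these are distinct, and [a], [b] are the
    next two successors of [v]. *)
Lemma next_not_involutive (t : seq V) v : uniq t -> (2 < size t)%N -> v \in t ->
  (next t v != v) && (next t (next t v) != v).
Proof.
move=> ut tgt2 vt; have [i [|a [|b t']] eq_t] := rot_to vt.
- by have := size_rot i t; rewrite eq_t => eqs; rewrite -eqs in tgt2.
- by have := size_rot i t; rewrite eq_t => eqs; rewrite -eqs in tgt2.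
rewrite -!(next_rot i ut) eq_t.
have : uniq (rot i t) by rewrite rot_uniq.
rewrite eq_t /= !inE !negb_or => /and3P[/and3P[va vb _] /andP[ab _] _].
by rewrite eqxx ![_ == v]eq_sym va (negPf va) eqxx.
Qed.

(** Orient each component by its cyclic list and glue the successor maps, fixing all other vertices;
    vertex-disjointness makes this well defined. *)
Lemma cycle_unions_perm C : C \in cycle_unions E ->
  exists2 s, cycle_perm E s & perm_edges s = cover C.
Proof.
rewrite inE => /and3P[_ /forall_inP isC /forall_inP disC].
(* Stated for every [F], with a dummy empty list outside [C], so that all lists can be chosen at
   once. *)
have cycle_seq F : exists t : seq V, F \in C ->
    [/\ uniq t, (2 < size t)%N, path.cycle (adj E) t
      & F = [set [set x; next t x] | x in t]].
  case: (boolP (F \in C)) => FC; last by exists [::].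
  have /existsP[k /existsP[t /and3P[kgt2 /andP[adjt ut] /eqP eqF]]] := isC F FC.
  by exists t; split; rewrite ?size_tuple.
have [t tP] := fin_all_exists cycle_seq.
have mem_t F v : F \in C -> (v \in cover F) = (v \in t F).
  move=> /tP[ut _ _ eqF].
  have memF e : (e \in F) = (e \in [set [set x; next (t F) x] | x in t F]).
    by rewrite -eqF.
  apply/bigcupP/idP=> [[e]|vt].
    by rewrite memF => /imsetP[x xt ->] /set2P[] ->; rewrite ?mem_next.
  exists [set v; next (t F) v]; last exact: set21.
  by rewrite memF; apply/imsetP; exists v.
pose comp v := [pick F in C | v \in cover F].
have compE F v : F \in C -> v \in cover F -> comp v = Some F.
  move=> FC vF; rewrite /comp; case: pickP => [F' /andP[F'C vF']|/(_ F)].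
    congr Some; apply/eqP/negP=> /negP neqF.
    have := forall_inP (disC _ F'C) _ FC; rewrite neqF /= => dis.
    by have := disjointFr dis vF'; rewrite vF.
  by rewrite FC vF.
pose nxt v := if comp v is Some F then next (t F) v else v.
(* The glued predecessor map is a left inverse, so [nxt] is a permutation. *)
pose prv v := if comp v is Some F then prev (t F) v else v.
have nxtK : cancel nxt prv.
  move=> v; rewrite /nxt; case eqc: (comp v) => [F|]; last by rewrite /prv eqc.
  move: eqc; rewrite /comp; case: pickP => // F' /andP[FC vF] [eqF].
  subst F'; have [ut _ _ _] := tP F FC.
  rewrite /prv (compE F) ?prev_next // mem_t // mem_next.
  by rewrite -mem_t.
pose s := perm (can_inj nxtK).
have sE F v : F \in C -> v \in t F -> s v = next (t F) v.
  by move=> FC vt; rewrite permE /nxt (compE F) // mem_t.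
have s_supp v : v \in perm_support s -> exists2 F, F \in C & v \in t F.
  rewrite inE permE /nxt /comp; case: pickP => [F /andP[FC vF] _|_]; last first.
    by rewrite eqxx.
  by exists F; rewrite // -mem_t.
exists s.
  apply/forall_inP=> v /s_supp[F FC vt]; have [ut gt2 adjt _] := tP F FC.
  have nvt : next (t F) v \in t F by rewrite mem_next.
  have /andP[_ nnv] := next_not_involutive ut gt2 vt.
  by rewrite !(sE F) // nnv andbT; exact: (next_cycle adjt vt).
apply/setP=> e; apply/imsetP/bigcupP=> [[v /s_supp[F FC vt] ->]|[F FC]].
  exists F => //; have [_ _ _ ->] := tP F FC.
  by apply/imsetP; exists v => //; rewrite (sE F).
have [ut gt2 _ ->] := tP F FC; case/imsetP=> v vt ->; exists v.
  by rewrite inE (sE F) //; have /andP[] := next_not_involutive ut gt2 vt.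
by rewrite (sE F).
Qed.

(** * Orientations of a union of cycles *)

Section Orientations.
Variable t : {perm V}.
Hypothesis cyc_t : cycle_perm E t.
Notation orbs := (porbit t @: perm_support t).
Implicit Types (D : {set {set V}}).

Definition reverse_on D (v : V) : V :=
  if v \in cover D then (t^-1)%g v else t v.

Lemma cover_orbits D v : D \subset orbs -> (t v \in cover D) = (v \in cover D).
Proof.
move=> sD; apply/bigcupP/bigcupP=> -[B BD vB]; exists B => //.
  by have /imsetP[x _ eqB] := subsetP sD B BD; rewrite eqB perm_in_porbit -eqB in vB *.
by have /imsetP[x _ eqB] := subsetP sD B BD; rewrite eqB perm_in_porbit -eqB.
Qed.

Lemma reverse_on_cover D v : D \subset orbs ->
  (reverse_on D v \in cover D) = (v \in cover D).
Proof.
move=> sD; rewrite /reverse_on; case: ifP => vD; last by rewrite cover_orbits.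
by rewrite -cover_orbits // permKV.
Qed.

Lemma reverse_on_inj D : D \subset orbs -> injective (reverse_on D).
Proof.
move=> sD u v eq_uv; have := reverse_on_cover u sD.
rewrite eq_uv reverse_on_cover // => eqD; move: eq_uv; rewrite /reverse_on eqD.
by case: ifP => _ /perm_inj.
Qed.

(** The test on [D] supplies the injectivity that [perm] needs; the fallback [t] only makes the
    function total. *)
Definition reverse_perm D : {perm V} :=
  if (D \subset orbs) =P true is ReflectT sD then perm (reverse_on_inj sD) else t.

Lemma reverse_permE D v : D \subset orbs -> reverse_perm D v = reverse_on D v.
Proof. by rewrite /reverse_perm; case: eqP => // sD; rewrite permE. Qed.

Lemma perm_support_inv v : ((t^-1)%g v != v) = (v \in perm_support t).
Proof. by rewrite inE -(inj_eq (@perm_inj _ t)) permKV eq_sym. Qed.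

Lemma perm_support_reverse D : D \subset orbs ->
  perm_support (reverse_perm D) = perm_support t.
Proof.
move=> sD; apply/setP=> v; rewrite inE reverse_permE // /reverse_on.
by case: ifP => _; rewrite ?perm_support_inv ?inE.
Qed.

(** Reversal only changes which endpoint carries an edge: the edge from v to [t v] becomes the one
    from [t v] back to v. *)
Lemma perm_edges_reverse D : D \subset orbs ->
  perm_edges (reverse_perm D) = perm_edges t.
Proof.
move=> sD; rewrite /perm_edges perm_support_reverse //.
apply/setP=> e; apply/imsetP/imsetP=> -[v vt ->].
  rewrite reverse_permE // /reverse_on; case: ifP => _; last by exists v.
  exists ((t^-1)%g v); first by rewrite -mem_perm_support permKV.
  by rewrite permKV setUC.
case: (boolP (v \in cover D)) => vD.
  exists (t v); first by rewrite mem_perm_support.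
  by rewrite reverse_permE // /reverse_on cover_orbits // vD permK setUC.
by exists v; rewrite // reverse_permE // /reverse_on (negPf vD).
Qed.

Lemma cycle_perm_reverse D : D \subset orbs -> cycle_perm E (reverse_perm D).
Proof.
move=> sD; have /forall_inP cyc := cyc_t; apply/forall_inP=> v vr.
have : [set v; reverse_perm D v] \in perm_edges (reverse_perm D) by exact: imset_f.
rewrite perm_edges_reverse // => /imsetP[w wt ->].
have /andP[-> _] /= := cyc w wt.
(* Two consecutive steps lie in the same orbit, so both use [t] or both use its inverse. *)
have := reverse_on_cover v sD; rewrite !reverse_permE // /reverse_on.
rewrite perm_support_reverse // in vr.
case: (boolP (v \in cover D)) => vD ->; last by have /andP[] := cyc v vr.
rewrite -(inj_eq (@perm_inj _ t)) permKV -(inj_eq (@perm_inj _ t)) permKV eq_sym.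
by have /andP[] := cyc v vr.
Qed.

(** At a point of an orbit reversed by only one of the two sets, [t] and its inverse would agree,
    giving a 2-cycle. *)
Lemma reverse_perm_inj : {in powerset orbs &, injective reverse_perm}.
Proof.
suff sub D D' : D \subset orbs -> D' \subset orbs ->
    reverse_perm D = reverse_perm D' -> D \subset D'.
  move=> D D'; rewrite !inE => sD sD' eqD.
  by apply/eqP; rewrite eqEsubset; apply/andP; split; apply: sub.
move=> sD sD' /permP eqD; apply/subsetP=> B BD.
have /imsetP[x xt eqB] := subsetP sD B BD.
have xD : x \in cover D by apply/bigcupP; exists B; rewrite // eqB porbit_id.
have := eqD x; rewrite !reverse_permE // /reverse_on xD.
case: ifP => [/bigcupP[B' B'D xB'] _|_ eq_x].
  have /imsetP[y _ eqB'] := subsetP sD' B' B'D.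
  suff -> : B = B' by [].
  by rewrite eqB eqB'; apply/eqP; rewrite eq_porbit_mem -eqB'.
have /forall_inP/(_ x xt)/andP[_] := cyc_t.
by rewrite -eq_x permKV eqxx.
Qed.

(** The edge of [s] at [v] joins some w to [t w], and [v] is either w or [t w]. *)
Lemma same_edges_step s v : perm_edges s = perm_edges t ->
  v \in perm_support t -> s v = t v \/ s v = (t^-1)%g v.
Proof.
move=> eq_st vt.
have vs : v \in perm_support s by rewrite -cover_perm_edges eq_st cover_perm_edges.
have : [set v; s v] \in perm_edges s by exact: imset_f.
rewrite eq_st => /imsetP[w wt /setP eq_vw].
have := eq_vw v; rewrite set21 => /esym/set2P[eq_v|eq_v].
  left; have := eq_vw (t w); rewrite set22 -eq_v => /set2P[] // tv.
  by move: vt; rewrite inE tv eqxx.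
right; have := eq_vw w; rewrite set21 eq_v permK => /set2P[tw|/esym//].
by move: vt; rewrite inE eq_v -!tw eqxx.
Qed.

(* Two permutations with the same edges are, on every orbit, either equal or
   inverse to each other: a 2-cycle would be needed to switch. *)
Lemma same_edges_reverse s : cycle_perm E s -> perm_edges s = perm_edges t ->
  exists2 D : {set {set V}}, D \subset orbs & s = reverse_perm D.
Proof.
move=> /forall_inP cyc_s eq_st.
have eq_supp : perm_support s = perm_support t.
  by rewrite -!cover_perm_edges eq_st.
pose X := [set x in perm_support t | s x == (t^-1)%g x].
(* Orbits of [t] are walked by its inverse ([porbitV]). If [s] moved forward along [t] from the
   predecessor of x, it would return to x and close a 2-cycle. *)
have inv x y : x \in X -> y \in porbit t x -> y \in X.
  rewrite -porbitV => xX /porbitP[i ->]; elim: i => [|i IHi].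
    by rewrite expg0 perm1.
  rewrite expgSr permM; move: {x xX}((t^-1 ^+ i)%g x) IHi => x.
  rewrite [in X in X -> _]in_set => /andP[xt /eqP sx].
  have wt : (t^-1)%g x \in perm_support t by rewrite -mem_perm_support permKV.
  rewrite in_set wt; case: (same_edges_step eq_st wt) => [|->]; last by rewrite eqxx.
  rewrite permKV -{1}sx => ssx.
  have /cyc_s/andP[_] : x \in perm_support s by rewrite eq_supp.
  by rewrite ssx eqxx.
have sD : porbit t @: X \subset orbs.
  by apply: imsetS; apply/subsetP=> x; rewrite inE => /andP[].
exists (porbit t @: X) => //; apply/permP=> v.
rewrite reverse_permE // /reverse_on; case: ifPn => vD.
  have /bigcupP[_ /imsetP[x xX ->] vx] := vD.
  by have := inv x v xX vx; rewrite inE => /andP[_ /eqP].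
case: (boolP (v \in perm_support t)) => vt; last first.
  have := vt; rewrite -eq_supp; move: vt; rewrite !inE !negbK.
  by move=> /eqP -> /eqP.
case: (same_edges_step eq_st vt) => // sv.
case/negP: vD; apply/bigcupP; exists (porbit t v); last exact: porbit_id.
by apply: imset_f; rewrite inE vt sv eqxx.
Qed.

(** Each nontrivial orbit is kept or reversed independently, so orientations correspond to subsets
    of the set of nontrivial orbits. *)
Lemma card_orientations :
  #|[set s | cycle_perm E s & perm_edges s == perm_edges t]| =
    (2 ^ #|cycle_family t|)%N.
Proof.
rewrite card_cycle_family -card_powerset -(card_in_imset reverse_perm_inj).
apply: eq_card => s; rewrite inE; apply/andP/imsetP=> [[cyc /eqP eq_st]|[D]].
  by have [D sD ->] := same_edges_reverse cyc eq_st; exists D; rewrite ?inE.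
rewrite inE => sD ->.
by rewrite cycle_perm_reverse // perm_edges_reverse.
Qed.

End Orientations.
End CycleFamilies.

(** * Grouping the permutations by their cycle families *)

Section LaplacianMatchings.
Variables (V : finType) (E : {set {set V}}) (A : comNzRingType).
Variables (c : {set V} -> A) (z : V -> A).
Hypothesis simpE : simple_graph E.
Notation S := (aug_subdivision E c z).
Notation n := #|V|.

(** On a 2-cycle both vertices would choose the edge joining them, against separation. *)
Lemma follows_cycle_perm (s : {perm V}) (f : {ffun V -> option {set V}}) :
  f \in family (incident E) -> separated f -> follows s f -> cycle_perm E s.
Proof.
move=> /familyP inc /separatedP sep /forall_inP fol; apply/forall_inP=> v vs.
have svs : s v \in perm_support s by rewrite mem_perm_support.
have := inc v; rewrite unfold_in (eqP (fol v vs)) => /andP[-> _] /=.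
apply/negP=> /eqP ssv.
have neq_v : s v != v by move: vs; rewrite inE.
have := sep _ _ neq_v; rewrite (eqP (fol v vs)) (eqP (fol _ svs)) ssv setUC.
by move/(_ erefl).
Qed.

Definition perm_term (s : {perm V}) : A :=
  (-1) ^+ #|cycle_family s| * ((\prod_(e in perm_edges s) c e) *
    matching_weight (delete_vertices S (support_subdivision s))
                    (n - #|perm_support s|)%N).

Lemma det_cycle_perms :
  \det (laplacian E c + diag_vertices z) =
    \sum_(s : {perm V} | cycle_perm E s) perm_term s.
Proof.
have -> : laplacian E c + diag_vertices z =
    \matrix_(i, j) laplacian_entry E c z (enum_val i) (enum_val j).
  by apply/matrixP=> i j; rewrite !mxE /laplacian_entry (inj_eq enum_val_inj).
rewrite det_enum_val sum_perm_laplacian_entry // [RHS]big_mkcond /=.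
apply: eq_bigr => s _; rewrite sign_cycle_family; case: ifPn => cyc.
  by rewrite sum_choices_matching.
rewrite big1 ?mulr0 // => f /andP[inc /andP[sep fol]].
by rewrite (follows_cycle_perm inc sep fol) in cyc.
Qed.

Lemma perm_support1 : perm_support (1 : {perm V})%g = set0.
Proof. by apply/setP=> v; rewrite !inE perm1 eqxx. Qed.

Lemma perm_term1 : perm_term 1%g = matching_weight S n.
Proof.
rewrite /perm_term /cycle_family /support_subdivision /perm_edges perm_support1.
rewrite !imset0 setU0 !cards0 big_set0 subn0 !mul1r /matching_weight.
apply: eq_bigl => M; congr (_ && _); rewrite /is_matching; congr (_ && _).
apply: eq_subset_r => i; rewrite inE -setI_eq0 setI0 eqxx andbT.
by [].
Qed.

Lemma cycle_unions_neq0 C : C \in cycle_unions E -> cover C != set0.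
Proof.
rewrite inE => /and3P[/set0Pn[F FC] /forall_inP cyc _].
have /set0Pn[x /bigcupP[e eF _]] := cover_cycle_neq0 (cyc F FC).
by apply/set0Pn; exists e; apply/bigcupP; exists F.
Qed.

(** The permutations with family [C] are its 2^p orientations, all with the same term of sign
    (-1)^p; hence the factor (-2)^p. *)
Lemma sum_cycle_family C : C \in cycle_unions E ->
  \sum_(s : {perm V} | (cycle_perm E s && (s != 1%g)) && (cycle_family s == C))
     perm_term s =
  (- 2%:R) ^+ n_cycles C * (\prod_(e in union_edges C) c e) *
    matching_weight (delete_vertices S (subdivision_vertices C))
                    (n - #|union_vertices C|)%N.
Proof.
move=> CE; have [t cyc_t edges_t] := cycle_unions_perm CE.
have nt1 s : perm_edges s = cover C -> s != 1%g.
  move=> eqs; apply: contraNneq (cycle_unions_neq0 CE) => s1.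
  by rewrite -eqs s1 /perm_edges perm_support1 imset0.
(* Injectivity of [cover] on cycle unions reduces equality of families to equality of edge sets,
   with [t] as reference orientation. *)
have familyE s : (cycle_perm E s && (s != 1%g)) && (cycle_family s == C) =
    (s \in [set s | cycle_perm E s & perm_edges s == perm_edges t]).
  rewrite inE edges_t; case: (boolP (cycle_perm E s)) => //= cyc.
  apply/andP/eqP=> [[_ /eqP <-]|eqs]; first by rewrite cover_cycle_family.
  split; first exact: nt1.
  apply/eqP; apply: (cover_cycle_unions_inj _ CE).
    by apply: cycle_family_unions => //; exact: nt1.
  by rewrite cover_cycle_family.
have term s : (cycle_perm E s && (s != 1%g)) && (cycle_family s == C) ->
    perm_term s = (-1) ^+ #|C| * ((\prod_(e in union_edges C) c e) *
      matching_weight (delete_vertices S (subdivision_vertices C))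
                      (n - #|union_vertices C|)%N).
  case/andP=> _ /eqP eqC.
  rewrite /perm_term /support_subdivision /subdivision_vertices /union_vertices.
  by rewrite /union_edges -eqC cover_cycle_family cover_perm_edges.
rewrite (eq_bigr _ term) (eq_bigl _ _ familyE) sumr_const card_orientations //.
have -> : cycle_family t = C.
  apply: (cover_cycle_unions_inj _ CE); last by rewrite cover_cycle_family.
  by apply: cycle_family_unions => //; exact: nt1.
by rewrite -[LHS]mulr_natl natrX !mulrA -exprMn mulrN1 /n_cycles.
Qed.

Theorem det_laplacian_matchings :
  \det (laplacian E c + diag_vertices z) =
    matching_weight S n +
    \sum_(C in cycle_unions E)
      (- 2%:R) ^+ n_cycles C * (\prod_(e in union_edges C) c e) *
      matching_weight (delete_vertices S (subdivision_vertices C))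
                      (n - #|union_vertices C|)%N.
Proof.
rewrite det_cycle_perms (bigD1 1%g) /=; last first.
  by apply/forall_inP=> v; rewrite perm_support1 inE.
rewrite perm_term1; congr (_ + _).
rewrite (partition_big (@cycle_family V) (mem (cycle_unions E))) /=; last first.
  by move=> s /andP[cyc s1]; exact: cycle_family_unions.
by apply: eq_bigr => C CE; exact: sum_cycle_family.
Qed.

End LaplacianMatchings.

Theorem mainTheorem11 (R : realFieldType) (V : finType) (E : {set {set V}})
    (c : {set V} -> R)
    (hsimple : simple_graph E) (hconn : connected_graph E)
    (hc : forall e : {set V}, e \in E -> 0 < c e) :
  let n := #|V| in
  let cP := fun e : {set V} => (c e)%:MP_[n] in
  let z := fun v : V => 'X_(enum_rank v) : {mpoly R[n]} in
  let S := aug_subdivision E cP z in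
  \det (map_mx (@mpolyC n R) (laplacian E c) + diag_vertices z) =
    matching_weight S n +
    \sum_(C in cycle_unions E)
      (- 2%:R) ^+ n_cycles C * (\prod_(e in union_edges C) cP e) *
      matching_weight (delete_vertices S (subdivision_vertices C))
                      (n - #|union_vertices C|)%N.
Proof.
(* The identity over an arbitrary commutative ring is applied to the polynomial ring; what remains
   is that the constant embedding, a ring morphism, commutes with forming the Laplacian. *)
move=> n cP z S; rewrite -(det_laplacian_matchings cP z hsimple).
congr (\det (_ + _)); apply/matrixP=> i j; rewrite !mxE /=.
case: ifP => _; first by rewrite rmorph_sum.
by case: ifP => _; rewrite ?rmorphN ?rmorph0.
Qed.
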